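(* Consider the network system $x_i^+=f_i(x_i,y_{\mathcal N_i},u_i,d_i)$, $y_i=h_i(x_i)$, $i=1,\dots,N$, and suppose all outputs $y_i$ are scalars. Suppose that, for a given vector of bounds $y^{\max}=(y_1^{\max},\dots,y_N^{\max})$, given disturbance bounds $\mathcal D_i$ and given sets $\mathcal S_i$ of states $x_i$, there exist feedback controllers $u_i=k_i(x_i,y_{\mathcal N_i},d_i)$ such that for every $i=1,\dots,N$: $$\forall x_i\in\mathcal S_i,\ \forall d_i\in\mathcal D_i,\ \forall\, |y_{\mathcal N_i}|\le y_{\mathcal N_i}^{\max}:\quad x_i^+=f_i\big(x_i,y_{\mathcal N_i},k_i(x_i,y_{\mathcal N_i},d_i),d_i\big)\in\mathcal S_i,$$ $$\max_{x_i\in\mathcal S_i}|h_i(x_i)|\le y_i^{\max},$$ where $y_{\mathcal N_i}^{\max}$ is the projection of $y^{\max}$ onto the coordinates in $\mathcal N_i$. Then every trajectory of the network satisfies $$\bigwedge_{i=1}^N\Big(x_i(0)\in\mathcal S_i\ \wedge\ \square\big(u_i=k_i(x_i,y_{\mathcal N_i},d_i)\big)\ \wedge\ \square(d_i\in\mathcal D_i)\Big)\ \Rightarrow\ \bigwedge_{i=1}^N\square(x_i\in\mathcal S_i),$$ that is, $\mathcal S_1\times\mathcal S_2\times\dots\times\mathcal S_N$ is robust control invariant for the network.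
   Context: For $i=1,\dots,N$, subsystem $\Sigma_i$ is a discrete-time system with state $x_i\in\mathcal X_i\subseteq\mathbb R^{n_i}$, control $u_i\in\mathcal U_i\subseteq\mathbb R^{m_i}$, disturbance $d_i\in\mathcal D_i\subseteq\mathbb R^{l_i}$ and output $y_i=h_i(x_i)$; $\mathcal N_i$ is the set of indices of the neighbours of $\Sigma_i$ and $y_{\mathcal N_i}$ is the stacked vector of outputs $y_j$, $j\in\mathcal N_i$. Controllers $k_i$ take values in $\mathcal U_i$. Absolute values and inequalities of vectors are componentwise. A trajectory of the network is a tuple of sequences $(x,y,u,d)(t)$, $t=0,1,2,\dots$, with $x_i(t+1)=f_i(x_i(t),y_{\mathcal N_i}(t),u_i(t),d_i(t))$ and $y_i(t)=h_i(x_i(t))$ for all $i,t$. $\square\,\psi$ means that $\psi$ holds at all times $t=0,1,2,\dots$. Robust control invariance of a set for a system under given disturbance bounds means: for every state in the set and every admissible disturbance there exists an admissible control such that the successor state is again in the set. For the whole network the neighbour outputs are those produced by the network itself, $y_j=h_j(x_j)$, so that $\mathcal S=\mathcal S_1\times\dots\times\mathcal S_N$ is robust control invariant if for all $x\in\mathcal S$ and all $d_i\in\mathcal D_i$ ($i=1,\dots,N$) there exist $u_i\in\mathcal U_i$ ($i=1,\dots,N$) such that $f_i(x_i,(h_j(x_j))_{j\in\mathcal N_i},u_i,d_i)\in\mathcal S_i$ for all $i$. *)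

(* Defs.v *)
From HB Require Import structures.
From mathcomp Require Import all_boot all_order all_algebra.
From mathcomp Require Import boolp classical_sets reals constructive_ereal ereal.

Set Implicit Arguments.
Unset Strict Implicit.
Unset Printing Implicit Defensive.

Import Order.TTheory GRing.Theory Num.Theory.

Local Open Scope classical_set_scope.
Local Open Scope ring_scope.

(* The vector of the coordinates of y with index in A, stacked in increasing
   order of the index. *)
Definition stack (R : Type) (N : nat) (A : {set 'I_N}) (y : 'cV[R]_N) :
  'cV[R]_#|A| := \col_(a < #|A|) y (enum_val a) 0.

Definition abs_le (R : realType) (p : nat) (v w : 'cV[R]_p) : Prop :=
  forall a : 'I_p, `|v a 0| <= w a 0.

(* The outputs are scalar.  The maps net_f and net_h are total on the ambient
   Euclidean spaces; their values outside of the sets net_X, net_U and net_D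
   are irrelevant. *)
Record network (R : realType) (N : nat) := Network {
  net_n : 'I_N -> nat;
  net_m : 'I_N -> nat;
  net_l : 'I_N -> nat;
  net_nbr : 'I_N -> {set 'I_N};
  net_X : forall i, set 'cV[R]_(net_n i);
  net_U : forall i, set 'cV[R]_(net_m i);
  net_D : forall i, set 'cV[R]_(net_l i);
  net_f : forall i, 'cV[R]_(net_n i) -> 'cV[R]_#|net_nbr i| ->
            'cV[R]_(net_m i) -> 'cV[R]_(net_l i) -> 'cV[R]_(net_n i);
  net_h : forall i, 'cV[R]_(net_n i) -> R
}.

Arguments net_X {R N} G i _ : rename.
Arguments net_U {R N} G i _ : rename.
Arguments net_D {R N} G i _ : rename.
Arguments net_f {R N} G i x yN u d : rename.
Arguments net_h {R N} G i x : rename.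

Section Network.
Context (R : realType) (N : nat) (G : network R N).

Definition net_state : Type := forall i, 'cV[R]_(net_n G i).
Definition net_control : Type := forall i, 'cV[R]_(net_m G i).
Definition net_disturbance : Type := forall i, 'cV[R]_(net_l G i).

Definition controllers : Type :=
  forall i, 'cV[R]_(net_n G i) -> 'cV[R]_#|net_nbr G i| ->
    'cV[R]_(net_l G i) -> 'cV[R]_(net_m G i).

Definition admissible_controllers (k : controllers) : Prop :=
  forall i x yN d, net_X G i x -> net_D G i d -> net_U G i (k i x yN d).

Definition net_output (x : net_state) : 'cV[R]_N := \col_j net_h G j (x j).

Definition net_step (x : net_state) (u : net_control) (d : net_disturbance) :
  net_state :=
  fun i => net_f G i (x i) (stack (net_nbr G i) (net_output x)) (u i) (d i).

Definition is_trajectory (x : nat -> net_state) (y : nat -> 'cV[R]_N)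
    (u : nat -> net_control) (d : nat -> net_disturbance) : Prop :=
  forall i t,
    x t.+1 i = net_f G i (x t i) (stack (net_nbr G i) (y t)) (u t i) (d t i) /\
    y t i 0 = net_h G i (x t i).

End Network.

Definition prod_set (I : Type) (T : I -> Type) (A : forall i, set (T i)) :
  set (forall i, T i) := [set x | forall i, A i (x i)].

(* The control may depend on the state and on the current disturbance. *)
Definition robust_control_invariant (X U D : Type) (F : X -> U -> D -> X)
    (Us : set U) (Ds : set D) (S : set X) : Prop :=
  forall x d, S x -> Ds d -> exists u, Us u /\ S (F x u d).

(* Main.v *)
Require Import Defs.
From HB Require Import structures.
From mathcomp Require Import all_boot all_order all_algebra.
From mathcomp Require Import boolp classical_sets reals constructive_ereal ereal.

Set Implicit Arguments.
Unset Strict Implicit.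
Unset Printing Implicit Defensive.

Import Order.TTheory GRing.Theory Num.Theory.

Local Open Scope classical_set_scope.
Local Open Scope ring_scope.

(** This is an assume-guarantee argument. If every [x j] lies in [S j], then [h_max] bounds every
    output by [ymax], which is exactly what [S_inv] assumes about the neighbours of each subsystem.
    There is no circularity: outputs depend only on the current state, so bounds now give membership
    one time step later. This closed-loop fact, [step], yields the trajectory claim by induction on
    time, and robust control invariance with the feedback [k] as control. *)

Theorem theorem2 (R : realType) (N : nat) (G : network R N)
  (ymax : 'cV[R]_N) (S : forall i : 'I_N, set 'cV[R]_(net_n G i))
  (k : controllers G)
  (S_sub_X : forall i, S i `<=` net_X G i)
  (k_adm : admissible_controllers k)
  (S_inv : forall i x d (yN : 'cV[R]_#|net_nbr G i|),
     S i x -> net_D G i d -> abs_le yN (stack (net_nbr G i) ymax) ->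
     S i (net_f G i x yN (k i x yN d) d))
  (h_max : forall i,
     (ereal_sup [set `|net_h G i x|%:E | x in S i] <= (ymax i 0)%:E)%E) :
  (forall (x : nat -> net_state G) (y : nat -> 'cV[R]_N)
     (u : nat -> net_control G) (d : nat -> net_disturbance G),
     is_trajectory x y u d ->
     (forall i, S i (x 0%N i) /\
        (forall t, u t i = k i (x t i) (stack (net_nbr G i) (y t)) (d t i)) /\
        (forall t, net_D G i (d t i))) ->
     forall i t, S i (x t i)) /\
  robust_control_invariant (@net_step R N G)
    (prod_set (net_U G)) (prod_set (net_D G)) (prod_set S).
Proof.
have step x d : prod_set S x -> prod_set (net_D G) d ->
    prod_set S (net_step x
      (fun i => k i (x i) (stack (net_nbr G i) (net_output x)) (d i)) d).
  (* Coordinate [a] belongs to the neighbour [enum_val a], whose output is one of the values under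
     the supremum in [h_max]; the bound passes to extended reals because that supremum lives
     there. *)
  move=> Sx Dd i; apply: S_inv => // a; rewrite !mxE -lee_fin.
  apply: le_trans (h_max _); apply: ereal_sup_ubound.
  by exists (x (enum_val a)).
split; last first.
  move=> x d Sx Dd.
  exists (fun i => k i (x i) (stack (net_nbr G i) (net_output x)) (d i)).
  (* [k_adm] speaks only of states in [net_X], hence [S_sub_X]. *)
  by split; [move=> i; apply: k_adm => //; apply: S_sub_X | exact: step].
(* The induction hypothesis must cover all [i] at once, since a successor state depends on the
   neighbours. *)
move=> x y u d traj init i t; elim: t i => [|t IH] i; first by have [] := init i.
have yE : y t = net_output (x t).
  by apply/colP => j; rewrite mxE; have [] := traj j t.
have [-> _] := traj i t; have [_ [-> _]] := init i; rewrite yE.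
by apply: (step (x t) (d t)) => // j; have [_ [_]] := init j.
Qed.
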